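(* Let $I\subseteq\mathbb{R}$ be either $(a,b)$, $(a,b]$, $[a,b)$ or $[a,b]$, where $-\infty\le a<b\le\infty$, let $\lambda,\mu: I\to\mathbb{C}$ be continuous, and let $t_0\in(a,b)$. Consider the system $$\bm{x}'=A(t)\bm{x},\qquad A(t)=\begin{pmatrix}\lambda(t)&\mu(t)\\0&\lambda(t)\end{pmatrix},\qquad (\ast)$$ and its fundamental matrix $X(t)=e^{\int_{t_0}^t\lambda(s)ds}\begin{pmatrix}1&\int_{t_0}^t\mu(s)ds\\0&1\end{pmatrix}$, $t\in I$. Then the following hold. (i) Suppose that $\kappa_{21}(t):=\int_t^b\left(1+\left|\int_t^s\mu(\tau)d\tau\right|\right)e^{-\int_t^s\Re(\lambda(\tau))d\tau}ds$ exists for all $t\in I$ and $\sup_{t\in I}\kappa_{21}(t)<\infty$. Then $(\ast)$ is Ulam stable on $I$, with an Ulam constant $K_{21}:=\sup_{t\in I}\kappa_{21}(t)$. Furthermore, if in addition $\lim_{t\to b-0}\int_{t_0}^t\Re(\lambda(s))ds=\infty$, then for any $\varepsilon>0$ and any continuously differentiable $\bm{\phi}: I\to\mathbb{C}^2$ satisfying $\sup_{t\in I}\|\bm{\phi}'(t)-A(t)\bm{\phi}(t)\|_\infty\le\varepsilon$, the limit $\lim_{t\to b-0}X^{-1}(t)\bm{\phi}(t)$ is a well-defined constant vector, and $\bm{x}(t)=X(t)\left(\lim_{s\to b-0}X^{-1}(s)\bm{\phi}(s)\right)$ is the unique solution of $(\ast)$ such that $\sup_{t\in I}\|\bm{\phi}(t)-\bm{x}(t)\|_\infty\le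 K_{21}\varepsilon$. (ii) Suppose that $\kappa_{22}(t):=\int_a^t\left(1+\left|\int_s^t\mu(\tau)d\tau\right|\right)e^{\int_s^t\Re(\lambda(\tau))d\tau}ds$ exists for all $t\in I$ and $\sup_{t\in I}\kappa_{22}(t)<\infty$. Then $(\ast)$ is Ulam stable on $I$, with an Ulam constant $K_{22}:=\sup_{t\in I}\kappa_{22}(t)$. Furthermore, if in addition $\lim_{t\to a+0}\int_t^{t_0}\Re(\lambda(s))ds=-\infty$, then for any $\varepsilon>0$ and any continuously differentiable $\bm{\phi}: I\to\mathbb{C}^2$ satisfying $\sup_{t\in I}\|\bm{\phi}'(t)-A(t)\bm{\phi}(t)\|_\infty\le\varepsilon$, the limit $\lim_{t\to a+0}X^{-1}(t)\bm{\phi}(t)$ is a well-defined constant vector, and $\bm{x}(t)=X(t)\left(\lim_{s\to a+0}X^{-1}(s)\bm{\phi}(s)\right)$ is the unique solution of $(\ast)$ such that $\sup_{t\in I}\|\bm{\phi}(t)-\bm{x}(t)\|_\infty\le K_{22}\varepsilon$.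
   Context: $\|(v_1,v_2)^T\|_\infty=\max\{|v_1|,|v_2|\}$ on $\mathbb{C}^2$, and $\Re(z)$ is the real part of $z$. The integrals defining the $\kappa$'s are possibly improper, and ''exists'' means that they converge. For continuous $A: I\to\mathbb{C}^{2\times2}$, the equation $\bm{x}'=A(t)\bm{x}$ is called Ulam stable on $I$ if there is a constant $K>0$ such that: for every $\varepsilon>0$ and every continuously differentiable $\bm{\phi}: I\to\mathbb{C}^2$ with $\sup_{t\in I}\|\bm{\phi}'(t)-A(t)\bm{\phi}(t)\|_\infty\le\varepsilon$, there exists a solution $\bm{x}: I\to\mathbb{C}^2$ of the equation with $\sup_{t\in I}\|\bm{\phi}(t)-\bm{x}(t)\|_\infty\le K\varepsilon$. Any such $K$ is called an Ulam constant for the equation on $I$. *)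

(* Defs.v *)
From Stdlib Require Import Reals.
From Coquelicot Require Export Coquelicot.

Open Scope R_scope.

(** The real interval [I] with endpoints [a] and [b], each either included or
    excluded.  [I] only contains real numbers, so that including an infinite
    endpoint makes no difference. *)
Definition interval_with_endpoints (I : R -> Prop) (a b : Rbar) : Prop :=
  (forall t : R, I t <-> Rbar_lt a t /\ Rbar_lt t b) \/
  (forall t : R, I t <-> Rbar_lt a t /\ Rbar_le t b) \/
  (forall t : R, I t <-> Rbar_le a t /\ Rbar_lt t b) \/
  (forall t : R, I t <-> Rbar_le a t /\ Rbar_le t b).

(** The filters "t -> b - 0" and "t -> a + 0"; for b = +oo and a = -oo they are
    the usual neighbourhoods of infinity. *)
Definition Rbar_at_left (b : Rbar) : (R -> Prop) -> Prop :=
  within (fun t : R => Rbar_lt t b) (Rbar_locally b).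
Definition Rbar_at_right (a : Rbar) : (R -> Prop) -> Prop :=
  within (fun t : R => Rbar_lt a t) (Rbar_locally a).

Definition sup_on (I : R -> Prop) (f : R -> R) : Rbar :=
  Lub_Rbar (fun y : R => exists t : R, I t /\ y = f t).

Definition Cexp (z : C) : C :=
  (exp (Re z) * cos (Im z), exp (Re z) * sin (Im z)).

(** Proper Riemann integral of a complex-valued function of a real variable. *)
Definition CInt (f : R -> C) (s t : R) : C :=
  RInt (V := C_R_CompleteNormedModule) f s t.

Definition C2 : Type := (C * C)%type.

(** C^2 as a normed space over R.  The product norm it carries is equivalent to
    [norm_inf] below and only serves for limits, continuity and derivatives. *)
Definition C2_R_NormedModule : NormedModule R_AbsRing :=
  prod_NormedModule R_AbsRing C_R_NormedModule C_R_NormedModule.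

Definition norm_inf (v : C2) : R := Rmax (Cmod (fst v)) (Cmod (snd v)).

Definition vsub (u v : C2) : C2 :=
  ((fst u - fst v)%C, (snd u - snd v)%C).

Record M22 : Type := mkM22 { m11 : C; m12 : C; m21 : C; m22 : C }.

Definition mscal (c : C) (M : M22) : M22 :=
  mkM22 (c * m11 M)%C (c * m12 M)%C (c * m21 M)%C (c * m22 M)%C.

Definition mvec (M : M22) (v : C2) : C2 :=
  ((m11 M * fst v + m12 M * snd v)%C, (m21 M * fst v + m22 M * snd v)%C).

Definition mdet (M : M22) : C := (m11 M * m22 M - m12 M * m21 M)%C.

(** Inverse matrix as adjugate over determinant (meaningful when the
    determinant is nonzero). *)
Definition minv (M : M22) : M22 :=
  mscal (/ mdet M)%C (mkM22 (m22 M) (- m12 M)%C (- m21 M)%C (m11 M)).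

(** [phi] has derivative [l] at [t] as a function on [I]: the same as
    [is_derive], except that the variable stays in [I], hence one-sided at an
    endpoint of [I]. *)
Definition is_derive_in (I : R -> Prop) (phi : R -> C2) (t : R) (l : C2) : Prop :=
  filterdiff (K := R_AbsRing) (U := R_NormedModule) (V := C2_R_NormedModule)
    phi (within I (locally t))
    (fun h : R => scal (V := C2_R_NormedModule) h l).

Definition C1_on (I : R -> Prop) (phi dphi : R -> C2) : Prop :=
  (forall t : R, I t -> is_derive_in I phi t (dphi t)) /\
  continuous_on (T := R_UniformSpace) (U := C2_R_NormedModule) I dphi.

Definition is_solution (I : R -> Prop) (A : R -> M22) (x : R -> C2) : Prop :=
  forall t : R, I t -> is_derive_in I x t (mvec (A t) (x t)).

Definition residual_le (I : R -> Prop) (A : R -> M22) (phi dphi : R -> C2)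
    (eps : R) : Prop :=
  Rbar_le (sup_on I (fun t => norm_inf (vsub (dphi t) (mvec (A t) (phi t))))) eps.

Definition distance_le (I : R -> Prop) (phi x : R -> C2) (r : R) : Prop :=
  Rbar_le (sup_on I (fun t => norm_inf (vsub (phi t) (x t)))) r.

Definition Ulam_constant (I : R -> Prop) (A : R -> M22) (K : R) : Prop :=
  0 < K /\
  forall eps : R, 0 < eps ->
  forall phi dphi : R -> C2, C1_on I phi dphi -> residual_le I A phi dphi eps ->
  exists x : R -> C2, is_solution I A x /\ distance_le I phi x (K * eps).

Definition Ulam_stable (I : R -> Prop) (A : R -> M22) : Prop :=
  exists K : R, Ulam_constant I A K.

(** [x] is the only solution within sup-distance [r] of [phi]; functions on [I]
    are represented by total functions, so uniqueness is equality on [I]. *)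
Definition unique_solution_within (I : R -> Prop) (A : R -> M22)
    (phi : R -> C2) (r : R) (x : R -> C2) : Prop :=
  (is_solution I A x /\ distance_le I phi x r) /\
  forall y : R -> C2, is_solution I A y -> distance_le I phi y r ->
  forall t : R, I t -> y t = x t.

Definition system_matrix (lambda mu : R -> C) (t : R) : M22 :=
  mkM22 (lambda t) (mu t) 0%C (lambda t).

Definition fundamental_matrix (lambda mu : R -> C) (t0 t : R) : M22 :=
  mscal (Cexp (CInt lambda t0 t)) (mkM22 1%C (CInt mu t0 t) 0%C 1%C).

Definition kappa21_integrand (lambda mu : R -> C) (t s : R) : R :=
  (1 + Cmod (CInt mu t s)) * exp (- RInt (fun tau => Re (lambda tau)) t s).

Definition kappa21 (lambda mu : R -> C) (b : Rbar) (t : R) : R :=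
  RInt_gen (kappa21_integrand lambda mu t) (at_point t) (Rbar_at_left b).

Definition kappa22_integrand (lambda mu : R -> C) (t s : R) : R :=
  (1 + Cmod (CInt mu s t)) * exp (RInt (fun tau => Re (lambda tau)) s t).

Definition kappa22 (lambda mu : R -> C) (a : Rbar) (t : R) : R :=
  RInt_gen (kappa22_integrand lambda mu t) (Rbar_at_right a) (at_point t).

(* Main.v *)
Require Import Defs.
From Stdlib Require Import Reals Lra Classical.
From Coquelicot Require Import Coquelicot.

(** Write [X(t) X(s)^-1] as the propagator [exp (p 1 + q N)], where [p], [q] are the
    integrals of [lambda], [mu] from [s] to [t] and [N] is nilpotent.  If [phi] has residual
    at most [eps], then [s |-> X(t) X(s)^-1 phi(s)] has a derivative of norm at most [eps]
    times the integrand of [kappa(t)].  For a fixed [t] its limit at the endpoint therefore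
    exists by the Cauchy criterion and equals [X(t) v] with [v = lim X^-1 phi]; its value at
    [s = t] is [phi(t)], so [|phi(t) - X(t) v| <= eps kappa(t)].  Uniqueness: two solutions at
    bounded distance differ by [X(t) w], and [|X(t) w|] is unbounded unless [w = 0].  The
    estimates are made on the open interval and extended to the endpoints by continuity. *)

Open Scope R_scope.

(** The integrand of kappa is a matrix norm: [(1 + |q|) exp (Re p)] is the largest absolute row sum
    of [exp (p 1 + q N)], hence its operator norm for the maximum norm. To obtain the supremum of
    kappa as the constant, without an extra factor, increments in C^2 are estimated coordinate by
    coordinate; the product norm is merely equivalent to [norm_inf]. The obstacle is an endpoint
    that belongs to [I]. Outside [I] the values of [lambda] and [mu] are arbitrary, so the integrals
    need not have an ordinary derivative there. In the open interval all derivatives are two-sided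
    and the usual calculus applies. At an included endpoint two facts are used instead: [X(t) v]
    satisfies the system in the one-sided sense, and functions differentiable along [I] are
    continuous along [I]. The two halves differ in orientation alone. Both integrands of kappa are
    the same function of the primitives, a sign [sigma] makes the integral from [t] towards the
    chosen endpoint positive, and both growth conditions say that the real part of the integral of
    [lambda] from [t0] to [t] tends to plus infinity. *)

(** * Derivatives of complex-valued functions of a real variable *)

Lemma norm_C_R (z : C) : norm (V := C_R_NormedModule) z = Cmod z.
Proof.
  unfold norm, Cmod; simpl; unfold prod_norm, norm; simpl; unfold abs; simpl.
  f_equal. rewrite !Rmult_1_r, <- !Rabs_mult.
  rewrite !Rabs_pos_eq; [ring| apply Rle_0_sqr..].
Qed.

Lemma is_derive_pair {U V : NormedModule R_AbsRing} (f : R -> U) (g : R -> V)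
    (t : R) (l : U) (m : V) :
  is_derive f t l -> is_derive g t m ->
  is_derive (V := prod_NormedModule R_AbsRing U V) (fun s => (f s, g s)) t (l, m).
Proof.
  intros Hf Hg.
  refine (filterdiff_comp'_2 f g (fun x y => (x, y)) t _ _ (fun x y => (x, y)) Hf Hg _).
  apply filterdiff_ext_lin with (fun u => u).
  apply filterdiff_ext with (fun u => u).
  now intros [].
  apply filterdiff_id.
  now intros [].
Qed.

Lemma is_derive_fst {U V : NormedModule R_AbsRing} (f : R -> U * V) (t : R) (l : U * V) :
  is_derive (V := prod_NormedModule R_AbsRing U V) f t l ->
  is_derive (fun s => fst (f s)) t (fst l).
Proof.
  intros Hf.
  apply (filterdiff_comp' f fst t _ fst Hf).
  apply filterdiff_linear, is_linear_fst.
Qed.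

Lemma is_derive_snd {U V : NormedModule R_AbsRing} (f : R -> U * V) (t : R) (l : U * V) :
  is_derive (V := prod_NormedModule R_AbsRing U V) f t l ->
  is_derive (fun s => snd (f s)) t (snd l).
Proof.
  intros Hf.
  apply (filterdiff_comp' f snd t _ snd Hf).
  apply filterdiff_linear, is_linear_snd.
Qed.

Lemma is_derive_C (f : R -> C) (t : R) (l : C) :
  is_derive (fun s => Re (f s)) t (Re l) -> is_derive (fun s => Im (f s)) t (Im l) ->
  is_derive (V := C_R_NormedModule) f t l.
Proof.
  intros Hr Hi. destruct l as [lr li].
  apply is_derive_ext with (fun s => (Re (f s), Im (f s))).
  intros s; now destruct (f s).
  exact (is_derive_pair _ _ t lr li Hr Hi).
Qed.

Lemma is_derive_Cconst (z : C) (t : R) :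
  is_derive (V := C_R_NormedModule) (fun _ => z) t (RtoC 0).
Proof. exact (is_derive_const (V := C_R_NormedModule) z t). Qed.

Lemma is_derive_Cplus (f g : R -> C) (t : R) (l m : C) :
  is_derive (V := C_R_NormedModule) f t l -> is_derive (V := C_R_NormedModule) g t m ->
  is_derive (V := C_R_NormedModule) (fun s => (f s + g s)%C) t (l + m)%C.
Proof. exact (is_derive_plus (V := C_R_NormedModule) f g t l m). Qed.

Lemma is_derive_Cminus (f g : R -> C) (t : R) (l m : C) :
  is_derive (V := C_R_NormedModule) f t l -> is_derive (V := C_R_NormedModule) g t m ->
  is_derive (V := C_R_NormedModule) (fun s => (f s - g s)%C) t (l - m)%C.
Proof. exact (is_derive_minus (V := C_R_NormedModule) f g t l m). Qed.

Lemma is_derive_Cmult (f g : R -> C) (t : R) (l m : C) :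
  is_derive (V := C_R_NormedModule) f t l -> is_derive (V := C_R_NormedModule) g t m ->
  is_derive (V := C_R_NormedModule) (fun s => (f s * g s)%C) t (l * g t + f t * m)%C.
Proof.
  intros Hf Hg.
  assert (Hf1 := is_derive_fst _ _ _ Hf). assert (Hf2 := is_derive_snd _ _ _ Hf).
  assert (Hg1 := is_derive_fst _ _ _ Hg). assert (Hg2 := is_derive_snd _ _ _ Hg).
  assert (H : forall n m : R, mult (K := R_AbsRing) n m = mult m n)
    by (intros; apply Rmult_comm).
  apply is_derive_C.
  - evar_last.
    exact (is_derive_minus (V := R_NormedModule) _ _ t _ _
             (is_derive_mult _ _ t _ _ Hf1 Hg1 H) (is_derive_mult _ _ t _ _ Hf2 Hg2 H)).
    unfold minus, plus, opp, mult; simpl; unfold Re; simpl; ring.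
  - evar_last.
    exact (is_derive_plus (V := R_NormedModule) _ _ t _ _
             (is_derive_mult _ _ t _ _ Hf1 Hg2 H) (is_derive_mult _ _ t _ _ Hf2 Hg1 H)).
    unfold minus, plus, opp, mult; simpl; unfold Im; simpl; ring.
Qed.

Lemma is_derive_Cexp (f : R -> C) (t : R) (l : C) :
  is_derive (V := C_R_NormedModule) f t l ->
  is_derive (V := C_R_NormedModule) (fun s => Cexp (f s)) t (Cexp (f t) * l)%C.
Proof.
  intros Hf.
  assert (Hf1 := is_derive_fst _ _ _ Hf). assert (Hf2 := is_derive_snd _ _ _ Hf).
  assert (He := is_derive_comp exp _ t _ _ (is_derive_exp _) Hf1).
  assert (Hc := is_derive_comp cos _ t _ _ (is_derive_cos _) Hf2).
  assert (Hs := is_derive_comp sin _ t _ _ (is_derive_sin _) Hf2).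
  assert (H : forall n m : R, mult (K := R_AbsRing) n m = mult m n)
    by (intros; apply Rmult_comm).
  apply is_derive_C.
  - evar_last.
    exact (is_derive_mult _ _ t _ _ He Hc H).
    unfold plus, mult, scal; simpl; unfold mult; simpl; unfold Re, Im; simpl; ring.
  - evar_last.
    exact (is_derive_mult _ _ t _ _ He Hs H).
    unfold plus, mult, scal; simpl; unfold mult; simpl; unfold Re, Im; simpl; ring.
Qed.

(** * The complex exponential *)

Lemma Cexp_plus (z w : C) : Cexp (z + w) = (Cexp z * Cexp w)%C.
Proof.
  destruct z as [x y], w as [u v]; unfold Cexp, Cmult, Cplus; simpl.
  rewrite exp_plus, cos_plus, sin_plus. f_equal; ring.
Qed.

Lemma Cexp_0 : Cexp 0 = 1%C.
Proof.
  unfold Cexp; simpl. rewrite exp_0, cos_0, sin_0.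
  unfold RtoC; f_equal; ring.
Qed.

Lemma Cexp_neq_0 (z : C) : Cexp z <> 0%C.
Proof.
  intros H. apply C1_nz. rewrite <- Cexp_0.
  replace (RtoC 0) with (z + - z)%C by ring.
  rewrite Cexp_plus, H; ring.
Qed.

Lemma Cmod_Cexp (z : C) : Cmod (Cexp z) = exp (Re z).
Proof.
  unfold Cmod, Cexp; simpl.
  replace (_ + _) with (exp (Re z) * exp (Re z)).
  apply sqrt_square, Rlt_le, exp_pos.
  assert (H := sin2_cos2 (Im z)); unfold Rsqr in H.
  transitivity (exp (Re z) * exp (Re z) * (sin (Im z) * sin (Im z) + cos (Im z) * cos (Im z))).
  rewrite H; ring. ring.
Qed.

(** * Continuity of complex-valued functions *)

Lemma continuous_pair {T U V : UniformSpace} (f : T -> U) (g : T -> V) (t : T) :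
  continuous f t -> continuous g t ->
  continuous (U := prod_UniformSpace U V) (fun s => (f s, g s)) t.
Proof.
  intros Hf Hg. apply (filterlim_locally (U := prod_UniformSpace U V)). intros eps.
  generalize (filter_and _ _ (proj1 (filterlim_locally _ _) Hf eps)
                (proj1 (filterlim_locally _ _) Hg eps)).
  now apply filter_imp.
Qed.

Lemma continuous_fst_comp {T U V : UniformSpace} (f : T -> U * V) (t : T) :
  continuous (U := prod_UniformSpace U V) f t -> continuous (fun s => fst (f s)) t.
Proof. intros Hf. apply (continuous_comp f fst t Hf), continuous_fst. Qed.

Lemma continuous_snd_comp {T U V : UniformSpace} (f : T -> U * V) (t : T) :
  continuous (U := prod_UniformSpace U V) f t -> continuous (fun s => snd (f s)) t.
Proof. intros Hf. apply (continuous_comp f snd t Hf), continuous_snd. Qed.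

Lemma continuous_Cplus {T : UniformSpace} (f g : T -> C) (t : T) :
  continuous (U := C_UniformSpace) f t -> continuous (U := C_UniformSpace) g t ->
  continuous (U := C_UniformSpace) (fun s => (f s + g s)%C) t.
Proof. exact (continuous_plus (V := C_R_NormedModule) f g t). Qed.

Lemma continuous_Cminus {T : UniformSpace} (f g : T -> C) (t : T) :
  continuous (U := C_UniformSpace) f t -> continuous (U := C_UniformSpace) g t ->
  continuous (U := C_UniformSpace) (fun s => (f s - g s)%C) t.
Proof. exact (continuous_minus (V := C_R_NormedModule) f g t). Qed.

Lemma continuous_Cmult {T : UniformSpace} (f g : T -> C) (t : T) :
  continuous (U := C_UniformSpace) f t -> continuous (U := C_UniformSpace) g t ->
  continuous (U := C_UniformSpace) (fun s => (f s * g s)%C) t.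
Proof.
  intros Hf Hg.
  assert (Hf1 := continuous_fst_comp _ _ Hf). assert (Hf2 := continuous_snd_comp _ _ Hf).
  assert (Hg1 := continuous_fst_comp _ _ Hg). assert (Hg2 := continuous_snd_comp _ _ Hg).
  apply (continuous_pair (U := R_UniformSpace) (V := R_UniformSpace)).
  - exact (continuous_minus (V := R_NormedModule) _ _ t
             (continuous_mult (K := R_AbsRing) _ _ t Hf1 Hg1)
             (continuous_mult (K := R_AbsRing) _ _ t Hf2 Hg2)).
  - exact (continuous_plus (V := R_NormedModule) _ _ t
             (continuous_mult (K := R_AbsRing) _ _ t Hf1 Hg2)
             (continuous_mult (K := R_AbsRing) _ _ t Hf2 Hg1)).
Qed.

Lemma continuous_Cmod {T : UniformSpace} (f : T -> C) (t : T) :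
  continuous (U := C_UniformSpace) f t -> continuous (fun s => Cmod (f s)) t.
Proof.
  intros Hf. apply continuous_ext with (fun s => norm (V := C_R_NormedModule) (f s)).
  intros s; apply norm_C_R.
  apply (continuous_comp f (norm (V := C_R_NormedModule)) t Hf).
  apply (filterlim_norm (V := C_R_NormedModule)).
Qed.

(** * The maximum norm on C^2 *)

Lemma norm_inf_ge_0 (v : C2) : 0 <= norm_inf v.
Proof. apply Rle_trans with (2 := Rmax_l _ _), Cmod_ge_0. Qed.

Lemma norm_inf_sym (u v : C2) : norm_inf (vsub u v) = norm_inf (vsub v u).
Proof.
  unfold norm_inf, vsub; simpl. f_equal; rewrite <- Cmod_opp; f_equal; ring.
Qed.

Lemma norm_inf_triangle (u v w : C2) :
  norm_inf (vsub u w) <= norm_inf (vsub u v) + norm_inf (vsub v w).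
Proof.
  apply Rmax_lub; simpl.
  - replace (fst u - fst w)%C with ((fst u - fst v) + (fst v - fst w))%C by ring.
    apply Rle_trans with (1 := Cmod_triangle _ _), Rplus_le_compat; apply Rmax_l.
  - replace (snd u - snd w)%C with ((snd u - snd v) + (snd v - snd w))%C by ring.
    apply Rle_trans with (1 := Cmod_triangle _ _), Rplus_le_compat; apply Rmax_r.
Qed.

Lemma norm_inf_eq_0 (u v : C2) : norm_inf (vsub u v) <= 0 -> u = v.
Proof.
  intros H. destruct u as [u1 u2], v as [v1 v2].
  assert (H1 := Rle_trans _ _ _ (Rmax_l _ _) H).
  assert (H2 := Rle_trans _ _ _ (Rmax_r _ _) H).
  simpl in H1, H2.
  assert (E1 : (u1 - v1)%C = 0%C) by (apply Cmod_eq_0, Rle_antisym; auto using Cmod_ge_0).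
  assert (E2 : (u2 - v2)%C = 0%C) by (apply Cmod_eq_0, Rle_antisym; auto using Cmod_ge_0).
  f_equal; [replace u1 with ((u1 - v1) + v1)%C by ring; rewrite E1
           |replace u2 with ((u2 - v2) + v2)%C by ring; rewrite E2]; ring.
Qed.

(** * Algebra and calculus of the propagator *)

(** [exp (p 1 + q N)] applied to [v], where [N] is the nilpotent matrix with upper
    right entry 1.  Hence [X(t)] is the propagator of the integrals of [lambda] and
    [mu], and products and inverses of such matrices become sums and opposites. *)
Definition propagator (p q : C) (v : C2) : C2 :=
  ((Cexp p * (fst v + q * snd v))%C, (Cexp p * snd v)%C).

Lemma propagator_0 (v : C2) : propagator 0 0 v = v.
Proof. destruct v; unfold propagator; simpl. rewrite Cexp_0; f_equal; ring. Qed.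

Lemma propagator_comp (p q p' q' : C) (v : C2) :
  propagator p q (propagator p' q' v) = propagator (p + p') (q + q') v.
Proof. unfold propagator; simpl. rewrite Cexp_plus; f_equal; ring. Qed.

Lemma propagator_sub (p q : C) (v w : C2) :
  propagator p q (vsub v w) = vsub (propagator p q v) (propagator p q w).
Proof. unfold propagator, vsub; simpl. f_equal; ring. Qed.

(** The first row of [exp p (1 + q N)] has absolute sum [(1 + |q|) exp (Re p)], the second only
    [exp (Re p)]. *)
Lemma propagator_norm (p q : C) (v : C2) :
  norm_inf (propagator p q v) <= (1 + Cmod q) * exp (Re p) * norm_inf v.
Proof.
  assert (Hv := norm_inf_ge_0 v). assert (Hq := Cmod_ge_0 q).
  assert (Hp := exp_pos (Re p)).
  assert (H1 : Cmod (fst v) <= norm_inf v) by apply Rmax_l.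
  assert (H2 : Cmod (snd v) <= norm_inf v) by apply Rmax_r.
  apply Rmax_lub; simpl; rewrite Cmod_mult, Cmod_Cexp.
  - rewrite (Rmult_comm (1 + _)), Rmult_assoc.
    apply Rmult_le_compat_l; [lra|].
    apply Rle_trans with (1 := Cmod_triangle _ _). rewrite Cmod_mult.
    assert (H := Rmult_le_compat_l _ _ _ Hq H2). lra.
  - rewrite (Rmult_comm (1 + _)), Rmult_assoc.
    apply Rmult_le_compat_l; [lra|].
    assert (H := Rmult_le_pos _ _ Hq Hv). lra.
Qed.

Lemma fundamental_matrix_propagator (lambda mu : R -> C) (t0 t : R) (v : C2) :
  mvec (fundamental_matrix lambda mu t0 t) v
  = propagator (CInt lambda t0 t) (CInt mu t0 t) v.
Proof. unfold mvec, propagator; simpl. f_equal; ring. Qed.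

(** The determinant of [X(t)] is the square of an exponential, hence nonzero, so the adjugate
    formula is the true inverse. *)
Lemma minv_fundamental_matrix (lambda mu : R -> C) (t0 t : R) (v : C2) :
  mvec (minv (fundamental_matrix lambda mu t0 t)) v
  = propagator (- CInt lambda t0 t) (- CInt mu t0 t) v.
Proof.
  assert (H : Cexp (- CInt lambda t0 t) = (/ Cexp (CInt lambda t0 t))%C).
  { assert (E : (Cexp (CInt lambda t0 t) * Cexp (- CInt lambda t0 t))%C = 1%C).
    { rewrite <- Cexp_plus, <- Cexp_0. f_equal. ring. }
    rewrite <- (Cmult_1_r (/ _)), <- E. field. apply Cexp_neq_0. }
  assert (Hn := Cexp_neq_0 (CInt lambda t0 t)).
  unfold mvec, propagator, minv, mdet; simpl. rewrite H.
  f_equal; field; auto.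
Qed.

(** All matrices [p 1 + q N] commute, so the derivative of the exponential factors out on the left
    and leaves [v' + (p' 1 + q' N) v]. *)
Lemma is_derive_propagator (p q : R -> C) (v : R -> C2) (t : R) (p' q' : C) (v' : C2) :
  is_derive (V := C_R_NormedModule) p t p' ->
  is_derive (V := C_R_NormedModule) q t q' ->
  is_derive (V := C2_R_NormedModule) v t v' ->
  is_derive (V := C2_R_NormedModule) (fun s => propagator (p s) (q s) (v s)) t
    (propagator (p t) (q t)
       ((fst v' + (p' * fst (v t) + q' * snd (v t)))%C, (snd v' + p' * snd (v t))%C)).
Proof.
  intros Hp Hq Hv.
  assert (Hv1 := is_derive_fst _ _ _ Hv). assert (Hv2 := is_derive_snd _ _ _ Hv).
  assert (He := is_derive_Cexp _ _ _ Hp).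
  evar_last.
  apply is_derive_pair.
  apply (is_derive_Cmult _ _ _ _ _ He (is_derive_Cplus _ _ _ _ _ Hv1 (is_derive_Cmult _ _ _ _ _ Hq Hv2))).
  apply (is_derive_Cmult _ _ _ _ _ He Hv2).
  unfold propagator; simpl. f_equal; ring.
Qed.

(** * Increments bounded by integrals *)

(** The increment is the integral of [h']; since the norm on C is exactly [Cmod], no constant is
    lost. *)
Lemma Cmod_increment_le (h h' : R -> C) (G : R -> R) (s1 s2 : R) :
  s1 <= s2 ->
  (forall s, s1 <= s <= s2 -> is_derive (V := C_R_NormedModule) h s (h' s)) ->
  (forall s, s1 <= s <= s2 -> continuous (U := C_UniformSpace) h' s) ->
  (forall s, s1 <= s <= s2 -> continuous G s) ->
  (forall s, s1 <= s <= s2 -> Cmod (h' s) <= G s) ->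
  Cmod (h s2 - h s1)%C <= RInt G s1 s2.
Proof.
  intros Hs Hd Hc HG Hb. rewrite <- norm_C_R.
  apply (norm_RInt_le (V := C_R_NormedModule) h' G s1 s2); auto.
  - intros s Is. rewrite norm_C_R; auto.
  - apply (is_RInt_derive (V := C_R_CompleteNormedModule) h h');
      rewrite Rmin_left, Rmax_right; auto.
  - apply (RInt_correct (V := R_CompleteNormedModule)), ex_RInt_continuous.
    rewrite Rmin_left, Rmax_right; auto.
Qed.

Lemma norm_inf_increment_le (h h' : R -> C2) (G : R -> R) (s1 s2 : R) :
  s1 <= s2 ->
  (forall s, s1 <= s <= s2 -> is_derive (V := C2_R_NormedModule) h s (h' s)) ->
  (forall s, s1 <= s <= s2 -> continuous (U := C2_R_NormedModule) h' s) ->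
  (forall s, s1 <= s <= s2 -> continuous G s) ->
  (forall s, s1 <= s <= s2 -> norm_inf (h' s) <= G s) ->
  norm_inf (vsub (h s2) (h s1)) <= RInt G s1 s2.
Proof.
  intros Hs Hd Hc HG Hb. apply Rmax_lub; simpl.
  - apply (Cmod_increment_le (fun s => fst (h s)) (fun s => fst (h' s))); auto.
    + intros s Is. exact (is_derive_fst _ _ _ (Hd s Is)).
    + intros s Is. exact (continuous_fst_comp _ _ (Hc s Is)).
    + intros s Is. apply Rle_trans with (2 := Hb s Is), Rmax_l.
  - apply (Cmod_increment_le (fun s => snd (h s)) (fun s => snd (h' s))); auto.
    + intros s Is. exact (is_derive_snd _ _ _ (Hd s Is)).
    + intros s Is. exact (continuous_snd_comp _ _ (Hc s Is)).
    + intros s Is. apply Rle_trans with (2 := Hb s Is), Rmax_r.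
Qed.

(** Continuity of the exponential factor is drawn from [is_derive_Cexp], whence the stronger
    hypothesis on [p] than on [q]. *)
Lemma continuous_propagator (p q : R -> C) (v : R -> C2) (t : R) :
  ex_derive (V := C_R_NormedModule) p t ->
  continuous (U := C_UniformSpace) q t ->
  continuous (U := C2_R_NormedModule) v t ->
  continuous (U := C2_R_NormedModule) (fun s => propagator (p s) (q s) (v s)) t.
Proof.
  intros [p' Hp] Hq Hv.
  assert (Hv1 := continuous_fst_comp _ _ Hv). assert (Hv2 := continuous_snd_comp _ _ Hv).
  assert (He : continuous (U := C_UniformSpace) (fun s => Cexp (p s)) t).
  { apply (ex_derive_continuous (V := C_R_NormedModule)).
    eexists. apply (is_derive_Cexp _ _ _ Hp). }
  apply (continuous_pair (U := C_UniformSpace) (V := C_UniformSpace));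
    apply continuous_Cmult; auto.
  apply continuous_Cplus; auto. apply continuous_Cmult; auto.
Qed.

(** * Limits and the Cauchy criterion in C^2 *)

Lemma filterlim_C2_norm_inf {T : Type} (F : (T -> Prop) -> Prop) {FF : Filter F}
    (h : T -> C2) (v : C2) :
  filterlim h F (locally (T := C2_R_NormedModule) v) ->
  forall eps, 0 < eps -> F (fun s => norm_inf (vsub (h s) v) < eps).
Proof.
  destruct v as [v1 v2]. intros Hh eps Heps.
  assert (H1 := filterlim_comp _ _ _ h fst F _ _ Hh
                  (continuous_fst (U := C_UniformSpace) (V := C_UniformSpace) v1 v2)).
  assert (H2 := filterlim_comp _ _ _ h snd F _ _ Hh
                  (continuous_snd (U := C_UniformSpace) (V := C_UniformSpace) v1 v2)).
  generalize (filter_and _ _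
    (proj1 (filterlim_locally_ball_norm (U := C_R_NormedModule) _ _) H1 (mkposreal _ Heps))
    (proj1 (filterlim_locally_ball_norm (U := C_R_NormedModule) _ _) H2 (mkposreal _ Heps))).
  apply filter_imp. intros s [B1 B2]. unfold ball_norm in B1, B2.
  rewrite norm_C_R in B1, B2. apply Rmax_lub_lt; assumption.
Qed.

(** A convergent [S] is Cauchy, and [h] inherits this because its increments are dominated by those
    of [S]; completeness does the rest. *)
Lemma Cauchy_C (F : (R -> Prop) -> Prop) {FF : ProperFilter F} (J : R -> Prop)
    (h : R -> C) (S : R -> R) (l : R) :
  F J -> filterlim S F (locally l) ->
  (forall s1 s2, J s1 -> J s2 -> Cmod (h s2 - h s1)%C <= Rabs (S s2 - S s1)) ->
  exists v : C, filterlim h F (locally (T := C_UniformSpace) v).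
Proof.
  intros FJ HS Hh.
  apply (filterlim_locally_cauchy (U := C_R_CompleteNormedModule)). intros eps.
  destruct (proj2 (filterlim_locally_cauchy (U := R_CompleteSpace) S) (ex_intro _ l HS) eps)
    as [P [FP HP]].
  exists (fun s => J s /\ P s). split. now apply filter_and.
  intros s1 s2 [J1 P1] [J2 P2].
  apply (norm_compat1 (V := C_R_NormedModule)).
  rewrite norm_C_R. apply Rle_lt_trans with (1 := Hh s1 s2 J1 J2).
  exact (HP s1 s2 P1 P2).
Qed.

Lemma Cauchy_C2 (F : (R -> Prop) -> Prop) {FF : ProperFilter F} (J : R -> Prop)
    (h : R -> C2) (S : R -> R) (l : R) :
  F J -> filterlim S F (locally l) ->
  (forall s1 s2, J s1 -> J s2 -> norm_inf (vsub (h s2) (h s1)) <= Rabs (S s2 - S s1)) ->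
  exists v : C2, filterlim h F (locally (T := C2_R_NormedModule) v).
Proof.
  intros FJ HS Hh.
  destruct (Cauchy_C F J (fun s => fst (h s)) S l FJ HS) as [v1 H1].
  { intros s1 s2 J1 J2. apply Rle_trans with (2 := Hh s1 s2 J1 J2), Rmax_l. }
  destruct (Cauchy_C F J (fun s => snd (h s)) S l FJ HS) as [v2 H2].
  { intros s1 s2 J1 J2. apply Rle_trans with (2 := Hh s1 s2 J1 J2), Rmax_r. }
  exists (v1, v2). apply (filterlim_locally (U := C2_R_NormedModule)). intros eps.
  generalize (filter_and _ _ (proj1 (filterlim_locally _ _) H1 eps)
                (proj1 (filterlim_locally _ _) H2 eps)).
  now apply filter_imp.
Qed.

(** * Estimates on the open interval *)

Lemma convex_between (J : R -> Prop)
    (J_convex : forall x y z, J x -> J y -> x <= z <= y -> J z) (s1 s2 s : R) :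
  J s1 -> J s2 -> Rmin s1 s2 <= s <= Rmax s1 s2 -> J s.
Proof.
  intros J1 J2. unfold Rmin, Rmax. destruct (Rle_dec s1 s2); intros H.
  now apply J_convex with s1 s2. now apply J_convex with s2 s1.
Qed.

(** The common form of both kappa integrands when [Lam] and [M] are primitives of [lambda] and [mu]:
    the modulus ignores the orientation of the integral of [mu], and the two exponents coincide. *)
Definition kernel (Lam M : R -> C) (t s : R) : R :=
  (1 + Cmod (M s - M t)%C) * exp (Re (Lam t) - Re (Lam s)).

(** [X(t) X(s)^-1 phi(s)] *)
Definition transport (Lam M : R -> C) (phi : R -> C2) (t s : R) : C2 :=
  propagator (Lam t - Lam s) (M t - M s) (phi s).

Section Interior.

Variables (J : R -> Prop) (lambda mu Lam M : R -> C) (sigma : R).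
Hypothesis J_convex : forall x y z, J x -> J y -> x <= z <= y -> J z.
Hypothesis Lam_derive : forall t, J t -> is_derive (V := C_R_NormedModule) Lam t (lambda t).
Hypothesis M_derive : forall t, J t -> is_derive (V := C_R_NormedModule) M t (mu t).
Hypothesis lambda_cont : forall t, J t -> continuous (U := C_UniformSpace) lambda t.
Hypothesis mu_cont : forall t, J t -> continuous (U := C_UniformSpace) mu t.
Hypothesis sigma_sign : sigma = 1 \/ sigma = -1.

Lemma kernel_pos (t s : R) : 0 < kernel Lam M t s.
Proof.
  apply Rmult_lt_0_compat, exp_pos. assert (H := Cmod_ge_0 (M s - M t)); lra.
Qed.

Lemma kernel_cont (t s : R) : J s -> continuous (kernel Lam M t) s.
Proof.
  intros Js.
  assert (CM : continuous (U := C_UniformSpace) M s)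
    by (apply (ex_derive_continuous (V := C_R_NormedModule)); eexists; now apply M_derive).
  assert (CL : continuous (U := C_UniformSpace) Lam s)
    by (apply (ex_derive_continuous (V := C_R_NormedModule)); eexists; now apply Lam_derive).
  apply (continuous_mult (K := R_AbsRing)).
  - apply (continuous_plus (V := R_NormedModule)). apply continuous_const.
    apply continuous_Cmod, continuous_Cminus; auto. apply continuous_const.
  - apply (continuous_comp (fun r => Re (Lam t) - Re (Lam r)) exp).
    + apply (continuous_minus (V := R_NormedModule)). apply continuous_const.
      exact (continuous_fst_comp _ _ CL).
    + apply (ex_derive_continuous (V := R_NormedModule) exp); eexists; apply is_derive_exp.
Qed.

Lemma system_cont (y : R -> C2) (s : R) : J s ->
  continuous (U := C2_R_NormedModule) y s ->
  continuous (U := C2_R_NormedModule) (fun r => mvec (system_matrix lambda mu r) (y r)) s.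
Proof.
  intros Js Cy.
  assert (C1 := continuous_fst_comp _ _ Cy). assert (C2 := continuous_snd_comp _ _ Cy).
  refine (continuous_pair (U := C_UniformSpace) (V := C_UniformSpace)
    (fun r => lambda r * fst (y r) + mu r * snd (y r))%C
    (fun r => 0 * fst (y r) + lambda r * snd (y r))%C s _ _);
    apply continuous_Cplus; apply continuous_Cmult; auto; apply continuous_const.
Qed.

Lemma ex_RInt_kernel (t s1 s2 : R) : J s1 -> J s2 -> ex_RInt (kernel Lam M t) s1 s2.
Proof.
  intros J1 J2. apply (ex_RInt_continuous (V := R_CompleteNormedModule)).
  intros s Hs. apply kernel_cont. now apply (convex_between J J_convex s1 s2).
Qed.

Lemma RInt_kernel_Chasles (t s1 s2 s3 : R) : J s1 -> J s2 -> J s3 ->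
  RInt (kernel Lam M t) s1 s3
  = RInt (kernel Lam M t) s1 s2 + RInt (kernel Lam M t) s2 s3.
Proof.
  intros J1 J2 J3. symmetry.
  apply (RInt_Chasles (V := R_CompleteNormedModule)); now apply ex_RInt_kernel.
Qed.

Lemma RInt_kernel_swap (t s1 s2 : R) : J s1 -> J s2 ->
  RInt (kernel Lam M t) s2 s1 = - RInt (kernel Lam M t) s1 s2.
Proof.
  intros J1 J2. symmetry.
  apply (opp_RInt_swap (V := R_CompleteNormedModule)); now apply ex_RInt_kernel.
Qed.

(** The condition on [s1], [s2] says that [s2] is nearer to the endpoint selected by [sigma]; the
    same sign then makes the oriented integral of the positive kernel positive. *)
Lemma RInt_kernel_pos (t s1 s2 : R) : J s1 -> J s2 -> 0 < sigma * (s2 - s1) ->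
  0 < sigma * RInt (kernel Lam M t) s1 s2.
Proof.
  intros J1 J2 Hs.
  assert (H : forall x y, J x -> J y -> x < y -> 0 < RInt (kernel Lam M t) x y).
  { intros x y Jx Jy Hxy. apply RInt_gt_0; auto.
    - intros; apply kernel_pos.
    - intros s Is. apply kernel_cont. now apply J_convex with x y. }
  destruct sigma_sign as [-> | ->].
  - rewrite Rmult_1_l. apply H; auto; lra.
  - replace (-1 * _) with (- RInt (kernel Lam M t) s1 s2) by ring.
    rewrite <- RInt_kernel_swap; auto. apply H; auto; lra.
Qed.

Definition approximate_solution (phi dphi : R -> C2) (eps : R) : Prop :=
  forall s, J s ->
    is_derive (V := C2_R_NormedModule) phi s (dphi s) /\
    continuous (U := C2_R_NormedModule) dphi s /\
    norm_inf (vsub (dphi s) (mvec (system_matrix lambda mu s) (phi s))) <= eps.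

Section Transport.

Variables (phi dphi : R -> C2) (eps : R).
Hypothesis eps_ge_0 : 0 <= eps.
Hypothesis phi_approx : approximate_solution phi dphi eps.

(** Variation of constants: differentiating [X(s)^-1] contributes [- X(s)^-1 A(s)], which turns
    [phi'] into the residual [phi' - A phi]. *)
Lemma transport_derive (t s : R) : J s ->
  is_derive (V := C2_R_NormedModule) (transport Lam M phi t) s
    (propagator (Lam t - Lam s) (M t - M s)
       (vsub (dphi s) (mvec (system_matrix lambda mu s) (phi s)))).
Proof.
  intros Js. evar_last.
  apply (is_derive_propagator (fun r => Lam t - Lam r)%C (fun r => M t - M r)%C phi).
  - apply is_derive_Cminus, Lam_derive, Js.
    apply is_derive_Cconst.
  - apply is_derive_Cminus, M_derive, Js.
    apply is_derive_Cconst.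
  - apply phi_approx, Js.
  - cbv beta. f_equal. unfold vsub, mvec; simpl.
    f_equal; ring.
Qed.

Lemma transport_increment_le (t s1 s2 : R) : J s1 -> J s2 -> s1 <= s2 ->
  norm_inf (vsub (transport Lam M phi t s2) (transport Lam M phi t s1))
  <= eps * RInt (kernel Lam M t) s1 s2.
Proof.
  intros J1 J2 Hs.
  (* The factor [eps] goes under the integral, so that [eps] times the kernel is the pointwise
     majorant of the derivative. *)
  change (eps * _) with (scal (V := R_CompleteNormedModule) eps (RInt (kernel Lam M t) s1 s2)).
  rewrite <- (RInt_scal (V := R_CompleteNormedModule)) by now apply ex_RInt_kernel.
  eapply norm_inf_increment_le; auto; intros s Is;
    assert (Js : J s) by now apply J_convex with s1 s2.
  - now apply transport_derive.
  - destruct (phi_approx s Js) as [Hd [Hc _]].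
    assert (Cphi : continuous (U := C2_R_NormedModule) phi s)
      by (apply ex_derive_continuous; eexists; exact Hd).
    apply continuous_propagator.
    + eexists. apply is_derive_Cminus, Lam_derive, Js.
      apply is_derive_Cconst.
    + apply continuous_Cminus. apply continuous_const.
      apply (ex_derive_continuous (V := C_R_NormedModule)); eexists; now apply M_derive.
    + exact (continuous_minus (V := C2_R_NormedModule) _ _ s Hc (system_cont phi s Js Cphi)).
  - apply (continuous_scal_r (V := R_NormedModule)). now apply kernel_cont.
  - apply Rle_trans with (1 := propagator_norm _ _ _).
    unfold scal; simpl; unfold mult; simpl. rewrite (Rmult_comm eps).
    unfold kernel. replace (Cmod (M s - M t)%C) with (Cmod (M t - M s)%C).
    apply Rmult_le_compat_l. apply Rlt_le.
    apply Rmult_lt_0_compat. assert (H := Cmod_ge_0 (M t - M s)); lra. apply exp_pos.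
    apply phi_approx, Js.
    rewrite <- Cmod_opp. f_equal. ring.
Qed.

Lemma transport_variation_le (t s1 s2 : R) : J s1 -> J s2 ->
  norm_inf (vsub (transport Lam M phi t s2) (transport Lam M phi t s1))
  <= eps * Rabs (RInt (kernel Lam M t) s1 s2).
Proof.
  intros J1 J2. destruct (Rle_lt_dec s1 s2) as [Hs | Hs].
  - apply Rle_trans with (1 := transport_increment_le t s1 s2 J1 J2 Hs).
    apply Rmult_le_compat_l, Rle_abs; auto.
  - rewrite norm_inf_sym, RInt_kernel_swap, Rabs_Ropp by auto.
    apply Rle_trans with (1 := transport_increment_le t s2 s1 J2 J1 (Rlt_le _ _ Hs)).
    apply Rmult_le_compat_l, Rle_abs; auto.
Qed.

Variables (F : (R -> Prop) -> Prop) (t0 : R).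
Context {FF : ProperFilter F}.
Hypothesis F_J : F J.
Hypothesis J_t0 : J t0.
Hypothesis Lam_t0 : Lam t0 = 0%C.
Hypothesis M_t0 : M t0 = 0%C.

(** Since [Lam] and [M] vanish at [t0], the transport to [t0] is [X^-1 phi] itself. The increments
    of [eps] times the convergent kernel integral dominate its own. *)
Lemma inverse_limit_exists (k : R) :
  filterlim (fun s => sigma * RInt (kernel Lam M t0) t0 s) F (locally k) ->
  exists v : C2,
    filterlim (fun s => propagator (- Lam s) (- M s) (phi s)) F
      (locally (T := C2_R_NormedModule) v).
Proof.
  intros Hk.
  apply Cauchy_C2 with (J := J)
    (S := fun s => eps * (sigma * RInt (kernel Lam M t0) t0 s)) (l := eps * k); auto.
  - apply (filterlim_comp _ _ _ _ (fun x => eps * x) F _ _ Hk).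
    apply (filterlim_scal_r (V := R_NormedModule) eps k).
  - intros s1 s2 J1 J2.
    assert (H := transport_variation_le t0 s1 s2 J1 J2).
    unfold transport in H. rewrite Lam_t0, M_t0 in H.
    unfold Cminus in H; rewrite !Cplus_0_l in H.
    apply Rle_trans with (1 := H).
    rewrite <- Rmult_minus_distr_l, Rabs_mult, (Rabs_pos_eq eps) by auto.
    apply Rmult_le_compat_l; auto.
    rewrite <- Rmult_minus_distr_l, Rabs_mult.
    replace (Rabs sigma) with 1.
    rewrite Rmult_1_l. apply Req_le. f_equal.
    assert (E : forall a b c : R, a = b + c -> c = a - b) by (intros; lra).
    apply E, RInt_kernel_Chasles; auto.
    destruct sigma_sign as [-> | ->]; [rewrite Rabs_R1 | rewrite Rabs_m1]; reflexivity.
Qed.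

(** The transport of [phi] from [s] to [t] joins the two vectors: it is [phi t] at [s = t], and
    close to the endpoint it is close to [X(t) v]. *)
Lemma distance_to_limit_le (t k : R) (v : C2) : J t ->
  F (fun s => 0 < sigma * (s - t)) ->
  filterlim (fun s => sigma * RInt (kernel Lam M t) t s) F (locally k) ->
  filterlim (fun s => propagator (- Lam s) (- M s) (phi s)) F
      (locally (T := C2_R_NormedModule) v) ->
  norm_inf (vsub (phi t) (propagator (Lam t) (M t) v)) <= eps * k.
Proof.
  intros Jt Ft Hk Hv.
  (* [c] bounds the operator norm of [X(t)], so an error below [d / 2 / c] in [X(s)^-1 phi(s)] costs
     at most [d / 2]. *)
  set (c := (1 + Cmod (M t)) * exp (Re (Lam t))).
  assert (Hc : 0 < c).
  { apply Rmult_lt_0_compat, exp_pos. assert (H := Cmod_ge_0 (M t)); lra. }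
  apply le_epsilon. intros d Hd.
  assert (Hd1 : 0 < d / 2 / c) by (apply Rdiv_lt_0_compat; lra).
  (* Dividing by [eps + 1] instead of [eps] covers the case [eps = 0]. *)
  assert (Hd2 : 0 < d / 2 / (eps + 1)) by (apply Rdiv_lt_0_compat; lra).
  destruct (filter_ex _ (filter_and _ _ F_J (filter_and _ _ Ft (filter_and _ _
    (filterlim_C2_norm_inf F _ v Hv _ Hd1)
    (proj1 (filterlim_locally _ _) Hk (mkposreal _ Hd2))))))
    as [s [Js [Hs [H1 H2]]]].
  assert (H3 : Rabs (sigma * RInt (kernel Lam M t) t s - k) < d / 2 / (eps + 1)) by exact H2.
  apply Rle_trans with (1 := norm_inf_triangle _ (transport Lam M phi t s) _).
  assert (H4 : norm_inf (vsub (phi t) (transport Lam M phi t s)) <= eps * k + d / 2).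
  { assert (E : phi t = transport Lam M phi t t).
    { unfold transport. replace (Lam t - Lam t)%C with (RtoC 0) by ring.
      replace (M t - M t)%C with (RtoC 0) by ring. now rewrite propagator_0. }
    rewrite E, norm_inf_sym.
    apply Rle_trans with (1 := transport_variation_le t t s Jt Js).
    assert (E2 : Rabs (RInt (kernel Lam M t) t s) = sigma * RInt (kernel Lam M t) t s).
    { assert (P := RInt_kernel_pos t t s Jt Js Hs).
      rewrite <- (Rabs_pos_eq _ (Rlt_le _ _ P)), Rabs_mult.
      destruct sigma_sign as [-> | ->]; [rewrite Rabs_R1 | rewrite Rabs_m1]; ring. }
    rewrite E2. apply Rabs_def2 in H3.
    apply Rle_trans with (eps * (k + d / 2 / (eps + 1))).
    apply Rmult_le_compat_l; lra.
    assert (eps * (d / 2 / (eps + 1)) <= d / 2); [|lra].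
    replace (d / 2) with ((eps + 1) * (d / 2 / (eps + 1))) at 2 by (field; lra).
    apply Rmult_le_compat_r; lra. }
  assert (H5 : norm_inf (vsub (transport Lam M phi t s) (propagator (Lam t) (M t) v)) <= d / 2).
  { unfold transport, Cminus. rewrite <- propagator_comp, <- propagator_sub.
    apply Rle_trans with (1 := propagator_norm _ _ _). fold c.
    replace (d / 2) with (c * (d / 2 / c)) by (field; lra).
    apply Rmult_le_compat_l; lra. }
  lra.
Qed.

End Transport.

(** An exact solution is an approximate one with [eps = 0], so its transport is constant in [s];
    comparing [s = t] with [s = t0] gives uniqueness for the initial value problem. *)
Lemma solution_propagator (y : R -> C2) (t0 t : R) :
  (forall s, J s -> is_derive (V := C2_R_NormedModule) y s
                      (mvec (system_matrix lambda mu s) (y s))) ->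
  J t0 -> Lam t0 = 0%C -> M t0 = 0%C -> J t ->
  y t = propagator (Lam t) (M t) (y t0).
Proof.
  intros Hy J0 HL HM Jt.
  assert (Ha : approximate_solution y (fun s => mvec (system_matrix lambda mu s) (y s)) 0).
  { intros s Js. split; [|split].
    - now apply Hy.
    - apply system_cont; auto.
      apply ex_derive_continuous; eexists; now apply Hy.
    - apply Rmax_lub; simpl; unfold Cminus; rewrite Cplus_opp_r, Cmod_0; lra. }
  assert (H := transport_variation_le _ _ 0 (Rle_refl 0) Ha t t t0 Jt J0).
  rewrite Rmult_0_l in H. apply norm_inf_eq_0 in H. unfold transport in H.
  rewrite HL, HM in H.
  replace (Lam t - Lam t)%C with (RtoC 0) in H by ring.
  replace (M t - M t)%C with (RtoC 0) in H by ring.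
  replace (Lam t - 0)%C with (Lam t) in H by ring.
  replace (M t - 0)%C with (M t) in H by ring.
  now rewrite propagator_0 in H.
Qed.

(** The second component of [X(t) (v - w)] has modulus [exp (Re (Lam t))] times a constant, so
    boundedness forces that constant to be zero. The contribution of [M] then disappears and the
    first component is treated alike. *)
Lemma bounded_propagator_unique (F : (R -> Prop) -> Prop) {FF : ProperFilter F}
    (v w : C2) (B : R) :
  F J -> filterlim (fun t => Re (Lam t)) F (Rbar_locally p_infty) ->
  (forall t, J t ->
     norm_inf (vsub (propagator (Lam t) (M t) v) (propagator (Lam t) (M t) w)) <= B) ->
  v = w.
Proof.
  intros FJ HF HB.
  assert (Hz : forall z : C, (forall t, J t -> exp (Re (Lam t)) * Cmod z <= B) -> z = 0%C).
  { intros z Hz. apply Cmod_eq_0.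
    destruct (Rle_lt_or_eq_dec _ _ (Cmod_ge_0 z)) as [Pz | <-]; auto. exfalso.
    (* Beyond this threshold [exp x >= 1 + x > B / |z|], which contradicts the bound. *)
    assert (FB : F (fun t => B / Cmod z < Re (Lam t))) by (apply HF; now exists (B / Cmod z)).
    destruct (filter_ex _ (filter_and _ _ FJ FB)) as [t [Jt Ht]].
    assert (H := Hz t Jt). assert (He := exp_ineq1_le (Re (Lam t))).
    assert (H2 : B / Cmod z * Cmod z < exp (Re (Lam t)) * Cmod z)
      by (apply Rmult_lt_compat_r; lra).
    replace (B / Cmod z * Cmod z) with B in H2 by (field; lra). lra. }
  assert (E2 : snd (vsub v w) = 0%C).
  { apply Hz. intros t Jt. apply Rle_trans with (2 := HB t Jt).
    rewrite <- propagator_sub, <- Cmod_Cexp, <- Cmod_mult. apply Rmax_r. }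
  assert (E1 : fst (vsub v w) = 0%C).
  { apply Hz. intros t Jt. apply Rle_trans with (2 := HB t Jt).
    rewrite <- propagator_sub, <- Cmod_Cexp, <- Cmod_mult.
    apply Rle_trans with (2 := Rmax_l _ _). unfold propagator; cbn [fst]. rewrite E2.
    apply Req_le; do 2 f_equal; ring. }
  apply norm_inf_eq_0. unfold norm_inf. rewrite E1, E2, Cmod_0, Rmax_left; lra.
Qed.

End Interior.

(** * Intervals with finite or infinite endpoints *)

Definition Rbar_interval (a b : Rbar) (t : R) : Prop := Rbar_lt a t /\ Rbar_lt t b.

Lemma Rbar_interval_convex (a b : Rbar) (x y z : R) :
  Rbar_interval a b x -> Rbar_interval a b y -> x <= z <= y -> Rbar_interval a b z.
Proof.
  intros [Hx _] [_ Hy] Hz. split.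
  - apply Rbar_lt_le_trans with x; auto. apply Hz.
  - apply Rbar_le_lt_trans with y; auto. apply Hz.
Qed.

Lemma Rbar_interval_open (a b : Rbar) (t : R) :
  Rbar_interval a b t -> locally t (Rbar_interval a b).
Proof.
  intros [H1 H2]. apply filter_and.
  - exact (open_Rbar_gt a t H1).
  - exact (open_Rbar_lt b t H2).
Qed.

Section Endpoints.

Variables (I : R -> Prop) (a b : Rbar).
Hypothesis hI : interval_with_endpoints I a b.

Lemma interval_between (t : R) : I t -> Rbar_le a t /\ Rbar_le t b.
Proof.
  destruct hI as [H | [H | [H | H]]]; intros Ht; apply H in Ht; destruct Ht;
    split; auto using Rbar_lt_le.
Qed.

Lemma Rbar_interval_incl (t : R) : Rbar_interval a b t -> I t.
Proof.
  intros [H1 H2].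
  destruct hI as [H | [H | [H | H]]]; apply H; split; auto using Rbar_lt_le.
Qed.

Lemma interval_convex (x y z : R) : I x -> I y -> x <= z <= y -> I z.
Proof.
  intros Ix Iy [Hx Hy].
  assert (Hx' : Rbar_le x z) by exact Hx. assert (Hy' : Rbar_le z y) by exact Hy.
  destruct hI as [H | [H | [H | H]]]; apply H in Ix; apply H in Iy; apply H;
    destruct Ix, Iy; split; eauto using Rbar_le_lt_trans, Rbar_lt_le_trans, Rbar_le_trans.
Qed.

Lemma Rbar_interval_left (t0 t s : R) :
  Rbar_interval a b t0 -> I t -> t < s <= t0 -> Rbar_interval a b s.
Proof.
  intros [_ H0] It [H1 H2]. apply interval_between in It. split.
  - apply Rbar_le_lt_trans with t; [apply It | exact H1].
  - apply Rbar_le_lt_trans with t0; auto.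
Qed.

Lemma Rbar_interval_right (t0 t s : R) :
  Rbar_interval a b t0 -> I t -> t0 <= s < t -> Rbar_interval a b s.
Proof.
  intros [H0 _] It [H1 H2]. apply interval_between in It. split.
  - apply Rbar_lt_le_trans with t0; auto.
  - apply Rbar_lt_le_trans with t; [exact H2 | apply It].
Qed.

(** A small step from [t] towards [t0] leaves a possible endpoint and enters the open interval. *)
Lemma Rbar_interval_dense (t0 t : R) (P : R -> Prop) :
  Rbar_interval a b t0 -> I t -> within I (locally t) P ->
  exists s, Rbar_interval a b s /\ P s.
Proof.
  intros H0 It [d Hd].
  assert (Hball : forall s, Rabs (s - t) < d -> Rbar_interval a b s -> P s).
  { intros s Hs Js. apply Hd. exact Hs. now apply Rbar_interval_incl. }
  assert (Pd := cond_pos d).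
  destruct (Rtotal_order t t0) as [Ht | [-> | Ht]].
  (* The bound [d / 2] keeps the point in the ball, and [t0 - t] prevents passing [t0]. *)
  - exists (t + Rmin (d / 2) (t0 - t)).
    assert (M1 := Rmin_l (d / 2) (t0 - t)). assert (M2 := Rmin_r (d / 2) (t0 - t)).
    assert (M3 : 0 < Rmin (d / 2) (t0 - t)) by (apply Rmin_glb_lt; lra).
    assert (J : Rbar_interval a b (t + Rmin (d / 2) (t0 - t)))
      by (apply Rbar_interval_left with t0 t; auto; lra).
    split; auto. apply Hball; auto.
    replace (_ - t) with (Rmin (d / 2) (t0 - t)) by ring. rewrite Rabs_pos_eq; lra.
  - exists t0. split; auto. apply Hball; auto.
    unfold Rminus; rewrite Rplus_opp_r, Rabs_R0; auto.
  - exists (t - Rmin (d / 2) (t - t0)).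
    assert (M1 := Rmin_l (d / 2) (t - t0)). assert (M2 := Rmin_r (d / 2) (t - t0)).
    assert (M3 : 0 < Rmin (d / 2) (t - t0)) by (apply Rmin_glb_lt; lra).
    assert (J : Rbar_interval a b (t - Rmin (d / 2) (t - t0)))
      by (apply Rbar_interval_right with t0 t; auto; lra).
    split; auto. apply Hball; auto.
    replace (_ - t) with (- Rmin (d / 2) (t - t0)) by ring.
    rewrite Rabs_Ropp, Rabs_pos_eq; lra.
Qed.

End Endpoints.

(** * Suprema and one-sided derivatives on [I] *)

Lemma sup_on_le (I : R -> Prop) (f : R -> R) (r : R) :
  Rbar_le (sup_on I f) r <-> forall t, I t -> f t <= r.
Proof.
  destruct (Lub_Rbar_correct (fun y => exists t, I t /\ y = f t)) as [Hub Hlub].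
  split.
  - intros H t It. change (Rbar_le (f t) r).
    apply Rbar_le_trans with (2 := H). apply Hub. now exists t.
  - intros H. apply Hlub. intros y [t [It ->]]. now apply H.
Qed.

(** [real] sends infinite values to 0. The hypothesis rules out plus infinity, and the point [t] of
    [I] rules out minus infinity. *)
Lemma le_sup_on (I : R -> Prop) (f : R -> R) (t : R) :
  Rbar_lt (sup_on I f) p_infty -> I t -> f t <= real (sup_on I f).
Proof.
  intros Hfin It.
  destruct (Lub_Rbar_correct (fun y => exists t, I t /\ y = f t)) as [Hub _].
  assert (H : Rbar_le (f t) (sup_on I f)) by (apply Hub; now exists t).
  destruct (sup_on I f); simpl in *; tauto.
Qed.

Lemma is_derive_in_interior (I : R -> Prop) (phi : R -> C2) (t : R) (l : C2) :
  locally t I -> is_derive_in I phi t l -> is_derive (V := C2_R_NormedModule) phi t l.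
Proof.
  intros LI [Hl Hd]. split. exact Hl.
  intros x Hx e.
  assert (Hx' : is_filter_lim (within I (locally t)) x).
  { intros P HP. apply filter_imp with (2 := Hx P HP). intros s Ps _; exact Ps. }
  generalize (filter_and _ _ LI (Hd x Hx' e)). apply filter_imp.
  intros s [Is Hs]. now apply Hs.
Qed.

Lemma within_locally_proper (I : R -> Prop) (t : R) :
  I t -> ProperFilter (within I (locally t)).
Proof.
  intros It. constructor; [|apply within_filter, locally_filter].
  intros P HP. exists t. exact (locally_singleton t _ HP It).
Qed.

(** This is how derivatives at an included endpoint are obtained: [f] is differentiable in the
    ordinary sense, while [g] may be arbitrary outside [I]. *)
Lemma is_derive_in_ext (I : R -> Prop) (f g : R -> C2) (t : R) (l : C2) :
  I t -> within I (locally t) (fun s => f s = g s) ->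
  is_derive (V := C2_R_NormedModule) f t l -> is_derive_in I g t l.
Proof.
  intros It Hfg Hf.
  assert (PF := within_locally_proper I t It).
  assert (Hlim : is_filter_lim (within I (locally t)) t).
  { intros P HP. apply filter_imp with (2 := HP). intros s Ps _; exact Ps. }
  apply filterdiff_ext_loc with f; auto.
  - intros x Hx.
    apply (is_filter_lim_unique (K := R_AbsRing) (V := R_NormedModule)) with (1 := Hlim) in Hx.
    rewrite <- Hx. exact (locally_singleton t _ Hfg It).
  - apply filterdiff_locally with t; auto.
Qed.

Lemma is_derive_in_continuous (I : R -> Prop) (f : R -> C2) (t : R) (l : C2) :
  is_derive_in I f t l ->
  filterlim f (within I (locally t)) (locally (T := C2_R_NormedModule) (f t)).
Proof.
  intros Hf.
  apply (filterdiff_continuous_aux (K := R_AbsRing) (U := R_NormedModule)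
           (V := C2_R_NormedModule)).
  - eexists; exact Hf.
  - intros P HP. apply filter_imp with (2 := HP). intros s Ps _; exact Ps.
Qed.

(** Both functions are continuous along [I], and the open interval comes arbitrarily close to every
    point of [I]. *)
Lemma distance_le_endpoints (I : R -> Prop) (a b : Rbar) (t0 : R) (f g f' g' : R -> C2)
    (r : R) :
  interval_with_endpoints I a b -> Rbar_interval a b t0 ->
  (forall t, I t -> is_derive_in I f t (f' t)) ->
  (forall t, I t -> is_derive_in I g t (g' t)) ->
  (forall t, Rbar_interval a b t -> norm_inf (vsub (f t) (g t)) <= r) ->
  forall t, I t -> norm_inf (vsub (f t) (g t)) <= r.
Proof.
  intros hI H0 Hf Hg Hr t It.
  apply le_epsilon. intros d Hd.
  assert (PF := within_locally_proper I t It).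
  assert (Hd2 : 0 < d / 2) by lra.
  assert (Cf := filterlim_C2_norm_inf _ _ _ (is_derive_in_continuous _ _ _ _ (Hf t It)) _ Hd2).
  assert (Cg := filterlim_C2_norm_inf _ _ _ (is_derive_in_continuous _ _ _ _ (Hg t It)) _ Hd2).
  destruct (Rbar_interval_dense I a b hI t0 t _ H0 It (filter_and _ _ Cf Cg))
    as [s [Js [H1 H2]]].
  apply Rle_trans with (1 := norm_inf_triangle _ (f s) _).
  assert (H3 := norm_inf_triangle (f s) (g s) (g t)).
  assert (H4 := Hr s Js).
  rewrite norm_inf_sym in H1. lra.
Qed.

(** * Primitives up to the endpoints of [I] *)

Definition clamp (x y s : R) : R := Rmax x (Rmin y s).

Lemma clamp_between (x y s : R) : x <= y -> x <= clamp x y s <= y.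
Proof.
  intros H. unfold clamp, Rmax, Rmin.
  destruct (Rle_dec y s), (Rle_dec x y); try destruct (Rle_dec x s); lra.
Qed.

Lemma clamp_id (x y s : R) : x <= s <= y -> clamp x y s = s.
Proof.
  intros H. unfold clamp. rewrite Rmin_right, Rmax_right; lra.
Qed.

Lemma clamp_continuous (x y s : R) : continuous (clamp x y) s.
Proof.
  (* Clamping is 1-Lipschitz, so [e] is its own modulus of continuity. *)
  apply (filterlim_locally (U := R_UniformSpace)). intros e. exists e. intros r Hr.
  change (Rabs (clamp x y r - clamp x y s) < e). change (Rabs (r - s) < e) in Hr.
  apply Rle_lt_trans with (2 := Hr).
  unfold clamp, Rmax, Rmin.
  repeat destruct Rle_dec; unfold Rabs; repeat destruct Rcase_abs; lra.
Qed.

(** Clamping to a compact part of [I] replaces a function that is only continuous on [I]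
    by one continuous on the whole line, so that one-sided derivatives of its integrals
    at the endpoints of [I] become two-sided ones. *)
Lemma continuous_on_extension (I : R -> Prop) (f : R -> C) (t0 t : R) :
  (forall x y z, I x -> I y -> x <= z <= y -> I z) ->
  continuous_on (T := R_UniformSpace) (U := C_UniformSpace) I f ->
  I t0 -> I t ->
  exists g : R -> C, (forall s, continuous (U := C_UniformSpace) g s) /\
    within I (locally t) (fun s => forall r, Rmin t0 s <= r <= Rmax t0 s -> g r = f r).
Proof.
  intros Iconv Hf I0 It.
  assert (Hx : exists x, I x /\ x <= t0 /\ x <= t /\ within I (locally t) (fun s => x <= s)).
  (* Either [I] has a point strictly to the left of [t0] and [t], which leaves room around [t], or
     the smaller of the two is the least element of [I]. *)
  { destruct (classic (exists u, I u /\ u < Rmin t0 t)) as [[u [Iu Hu]] | Hn].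
    - exists u. assert (H1 := Rmin_l t0 t). assert (H2 := Rmin_r t0 t).
      repeat split; auto; try lra.
      assert (Hut : u < t) by lra. generalize (open_gt u t Hut).
      unfold within. apply filter_imp. intros s Hs _. now apply Rlt_le.
    - exists (Rmin t0 t). repeat split.
      + unfold Rmin; destruct Rle_dec; auto.
      + apply Rmin_l.
      + apply Rmin_r.
      + unfold within. apply filter_forall. intros s Is. apply Rnot_lt_le. intros Hs.
        apply Hn. now exists s. }
  assert (Hy : exists y, I y /\ t0 <= y /\ t <= y /\ within I (locally t) (fun s => s <= y)).
  { destruct (classic (exists u, I u /\ Rmax t0 t < u)) as [[u [Iu Hu]] | Hn].
    - exists u. assert (H1 := Rmax_l t0 t). assert (H2 := Rmax_r t0 t).
      repeat split; auto; try lra.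
      assert (Hut : t < u) by lra. generalize (open_lt u t Hut).
      unfold within. apply filter_imp. intros s Hs _. now apply Rlt_le.
    - exists (Rmax t0 t). repeat split.
      + unfold Rmax; destruct Rle_dec; auto.
      + apply Rmax_l.
      + apply Rmax_r.
      + unfold within. apply filter_forall. intros s Is. apply Rnot_lt_le. intros Hs.
        apply Hn. now exists s. }
  destruct Hx as [x [Ix [Hx0 [Hxt Hxs]]]]. destruct Hy as [y [Iy [Hy0 [Hyt Hys]]]].
  assert (Hxy : x <= y) by lra.
  exists (fun s => f (clamp x y s)). split.
  - intros s.
    assert (Ic : forall r, I (clamp x y r))
      by (intros r; apply (Iconv x y); auto; now apply clamp_between).
    apply (filterlim_comp _ _ _ (clamp x y) f _ (within I (locally (clamp x y s)))).
    + intros P HP. generalize (clamp_continuous x y s _ HP).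
      unfold filtermap. apply filter_imp. intros r Hr. now apply Hr.
    + apply (Hf (clamp x y s)). apply Ic.
  - generalize (filter_and _ _ Hxs Hys). unfold within. apply filter_imp.
    intros s H Is r Hr. destruct (H Is) as [H1 H2].
    f_equal. apply clamp_id.
    revert Hr. unfold Rmin, Rmax; destruct Rle_dec; lra.
Qed.

(** [P] integrates a continuous extension that agrees with [f] between [t0] and [s], so the
    integrals coincide along [I] while [P] has a two-sided derivative even at an endpoint. *)
Lemma CInt_primitive (I : R -> Prop) (f : R -> C) (t0 t : R) :
  (forall x y z, I x -> I y -> x <= z <= y -> I z) ->
  continuous_on (T := R_UniformSpace) (U := C_UniformSpace) I f ->
  I t0 -> I t ->
  exists P : R -> C, is_derive (V := C_R_NormedModule) P t (f t) /\
    within I (locally t) (fun s => P s = CInt f t0 s).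
Proof.
  intros Iconv Hf I0 It.
  destruct (continuous_on_extension I f t0 t Iconv Hf I0 It) as [g [Hg Hgf]].
  exists (CInt g t0). split.
  - rewrite <- (locally_singleton t _ Hgf It t).
    + apply (is_derive_RInt (V := C_R_NormedModule) g _ t0 t); auto.
      apply filter_forall. intros s.
      apply (RInt_correct (V := C_R_CompleteNormedModule)), ex_RInt_continuous.
      intros; apply Hg.
    + split. apply Rmin_r. apply Rmax_r.
  - generalize Hgf. unfold within. apply filter_imp. intros s Hs Is.
    apply (RInt_ext (V := C_R_CompleteNormedModule)). intros r Hr. apply Hs; auto. lra.
Qed.

(** * The system on [I] and its fundamental matrix *)

Section System.

Variables (I : R -> Prop) (a b : Rbar) (lambda mu : R -> C) (t0 : R).
Hypothesis hI : interval_with_endpoints I a b.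
Hypothesis hlambda : continuous_on (T := R_UniformSpace) (U := C_UniformSpace) I lambda.
Hypothesis hmu : continuous_on (T := R_UniformSpace) (U := C_UniformSpace) I mu.
Hypothesis ht0 : Rbar_interval a b t0.

Let J := Rbar_interval a b.
Let A := system_matrix lambda mu.
Let X := fundamental_matrix lambda mu t0.
Let Lam := CInt lambda t0.
Let M := CInt mu t0.

Lemma J_locally_I (t : R) : J t -> locally t I.
Proof.
  intros Jt. generalize (Rbar_interval_open a b t Jt). apply filter_imp.
  intros s; now apply Rbar_interval_incl.
Qed.

Lemma continuous_interior {U : UniformSpace} (f : R -> U) (t : R) :
  continuous_on (T := R_UniformSpace) I f -> J t -> continuous f t.
Proof.
  intros Hf Jt P HP.
  assert (It : I t) by now apply (Rbar_interval_incl I a b hI).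
  generalize (filter_and _ _ (J_locally_I t Jt) (Hf t It P HP)).
  unfold filtermap. apply filter_imp. intros s [Is Hs]. now apply Hs.
Qed.

Lemma CInt_derive (f : R -> C) (t : R) :
  continuous_on (T := R_UniformSpace) (U := C_UniformSpace) I f -> J t ->
  is_derive (V := C_R_NormedModule) (CInt f t0) t (f t).
Proof.
  intros Hf Jt.
  destruct (CInt_primitive I f t0 t (interval_convex I a b hI) Hf) as [P [HP HPf]];
    try now apply (Rbar_interval_incl I a b hI).
  apply is_derive_ext_loc with (2 := HP).
  generalize (filter_and _ _ (J_locally_I t Jt) HPf). apply filter_imp.
  intros s [Is Hs]. now apply Hs.
Qed.

Lemma CInt_Chasles (f : R -> C) (s t : R) :
  continuous_on (T := R_UniformSpace) (U := C_UniformSpace) I f -> J s -> J t ->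
  CInt f s t = (CInt f t0 t - CInt f t0 s)%C.
Proof.
  intros Hf Js Jt.
  assert (Hex : forall x y, J x -> J y -> ex_RInt (V := C_R_CompleteNormedModule) f x y).
  { intros x y Jx Jy. apply ex_RInt_continuous. intros r Hr.
    apply (continuous_interior (U := C_UniformSpace)); auto.
    now apply (convex_between _ (Rbar_interval_convex a b) x y). }
  assert (E : forall x y z : C, (x + y)%C = z -> y = (z - x)%C) by (intros; subst; ring).
  apply E. apply (RInt_Chasles (V := C_R_CompleteNormedModule) f t0 s t); auto.
Qed.

Lemma RInt_Re (f : R -> C) (s t : R) :
  continuous_on (T := R_UniformSpace) (U := C_UniformSpace) I f -> J s -> J t ->
  RInt (fun r => Re (f r)) s t = Re (CInt f s t).
Proof.
  intros Hf Js Jt.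
  apply (is_RInt_unique (V := R_CompleteNormedModule)).
  apply (is_RInt_fct_extend_fst (U := R_NormedModule) (V := R_NormedModule) f).
  apply (RInt_correct (V := C_R_CompleteNormedModule)), ex_RInt_continuous.
  intros r Hr. apply (continuous_interior (U := C_UniformSpace)); auto.
  now apply (convex_between _ (Rbar_interval_convex a b) s t).
Qed.

Lemma CInt_t0 (f : R -> C) : CInt f t0 t0 = 0%C.
Proof. exact (RInt_point (V := C_R_CompleteNormedModule) t0 f). Qed.

Lemma kappa21_integrand_kernel (t s : R) : J t -> J s ->
  kappa21_integrand lambda mu t s = kernel Lam M t s.
Proof.
  intros Jt Js. unfold kappa21_integrand, kernel.
  rewrite RInt_Re, (CInt_Chasles mu t s), (CInt_Chasles lambda t s) by auto.
  f_equal. f_equal. unfold Lam, Re; simpl. ring.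
Qed.

Lemma kappa22_integrand_kernel (t s : R) : J t -> J s ->
  kappa22_integrand lambda mu t s = kernel Lam M t s.
Proof.
  intros Jt Js. unfold kappa22_integrand, kernel.
  rewrite RInt_Re, (CInt_Chasles mu s t), (CInt_Chasles lambda s t) by auto.
  f_equal. f_equal. rewrite <- Cmod_opp. f_equal. unfold M. ring.
Qed.

(** Near [t] the matrix [X] agrees along [I] with the propagator of two differentiable primitives,
    which covers the endpoints too. *)
Lemma fundamental_matrix_solution (v : C2) : is_solution I A (fun t => mvec (X t) v).
Proof.
  intros t It.
  assert (I0 : I t0) by now apply (Rbar_interval_incl I a b hI).
  destruct (CInt_primitive I lambda t0 t (interval_convex I a b hI) hlambda I0 It)
    as [P [HP HPf]].
  destruct (CInt_primitive I mu t0 t (interval_convex I a b hI) hmu I0 It)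
    as [Q [HQ HQf]].
  apply is_derive_in_ext with (fun s => propagator (P s) (Q s) v); auto.
  - generalize (filter_and _ _ HPf HQf). unfold within. apply filter_imp.
    intros s H Is. destruct (H Is) as [H1 H2].
    unfold X. now rewrite fundamental_matrix_propagator, H1, H2.
  - assert (EP := locally_singleton t _ HPf It). assert (EQ := locally_singleton t _ HQf It).
    evar_last.
    apply (is_derive_propagator P Q (fun _ => v) t _ _ (RtoC 0, RtoC 0) HP HQ).
    apply (is_derive_const (V := C2_R_NormedModule)).
    unfold X, A. rewrite fundamental_matrix_propagator, <- EP, <- EQ.
    unfold propagator, mvec; simpl. f_equal; ring.
Qed.

Section Direction.

(** The two halves of the theorem: [F] is the filter of the endpoint from which the
    integrals [kappa] are taken, and [sigma] is [1] for [b] and [-1] for [a]. *)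
Variables (F : (R -> Prop) -> Prop) (sigma : R) (kappa : R -> R).
Context {FF : ProperFilter F}.
Hypothesis F_J : F J.
Hypothesis sigma_sign : sigma = 1 \/ sigma = -1.
Hypothesis F_beyond : forall t, J t -> F (fun s => 0 < sigma * (s - t)).
Hypothesis kappa_limit : forall t, J t ->
  filterlim (fun s => sigma * RInt (kernel Lam M t) t s) F (locally (kappa t)).
Hypothesis kappa_bounded : Rbar_lt (sup_on I kappa) p_infty.

Let K := real (sup_on I kappa).

Let J_convex := Rbar_interval_convex a b.
Let Lam_derive := fun t => CInt_derive lambda t hlambda.
Let M_derive := fun t => CInt_derive mu t hmu.
Let lambda_cont := fun t => continuous_interior (U := C_UniformSpace) lambda t hlambda.
Let mu_cont := fun t => continuous_interior (U := C_UniformSpace) mu t hmu.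

Lemma kappa_le (t : R) : J t -> kappa t <= K.
Proof.
  intros Jt. apply le_sup_on; auto. now apply (Rbar_interval_incl I a b hI).
Qed.

(** Already [kappa t0] is positive: it is at least the positive integral from [t0] to some [t1]
    nearer the endpoint, because what lies beyond [t1] adds a positive amount. *)
Lemma K_pos : 0 < K.
Proof.
  apply Rlt_le_trans with (2 := kappa_le t0 ht0).
  destruct (filter_ex _ (filter_and _ _ F_J (F_beyond t0 ht0))) as [t1 [J1 H1]].
  apply Rlt_le_trans with (sigma * RInt (kernel Lam M t0) t0 t1).
  { now apply (RInt_kernel_pos J lambda mu). }
  apply (closed_filterlim_loc (U := R_UniformSpace) (fun s => sigma * RInt (kernel Lam M t0) t0 s)
    (fun x => sigma * RInt (kernel Lam M t0) t0 t1 <= x)) with (1 := kappa_limit t0 ht0).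
  - generalize (filter_and _ _ F_J (F_beyond t1 J1)). apply filter_imp.
    intros s [Js Hs].
    rewrite (RInt_kernel_Chasles J lambda mu Lam M J_convex Lam_derive M_derive t0 t0 t1 s)
      by auto.
    rewrite Rmult_plus_distr_l.
    assert (P : 0 < sigma * RInt (kernel Lam M t0) t1 s)
      by now apply (RInt_kernel_pos J lambda mu).
    lra.
  - apply closed_ge.
Qed.

Lemma approximate_interior (phi dphi : R -> C2) (eps : R) :
  C1_on I phi dphi -> residual_le I A phi dphi eps ->
  approximate_solution J lambda mu phi dphi eps.
Proof.
  intros [Hd Hc] Hr s Js.
  assert (Is : I s) by now apply (Rbar_interval_incl I a b hI).
  split; [|split].
  - apply is_derive_in_interior with I; auto. now apply J_locally_I.
  - now apply continuous_interior.
  - now apply (proj1 (sup_on_le I _ eps) Hr).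
Qed.

Lemma limit_solution (phi dphi : R -> C2) (eps : R) :
  0 < eps -> C1_on I phi dphi -> residual_le I A phi dphi eps ->
  exists v : C2,
    filterlim (fun t => mvec (minv (X t)) (phi t)) F (locally (T := C2_R_NormedModule) v) /\
    is_solution I A (fun t => mvec (X t) v) /\
    distance_le I phi (fun t => mvec (X t) v) (K * eps).
Proof.
  intros Heps HC Hr.
  assert (Happ := approximate_interior phi dphi eps HC Hr).
  assert (Heps' := Rlt_le _ _ Heps).
  destruct (inverse_limit_exists J lambda mu Lam M sigma J_convex Lam_derive M_derive
    lambda_cont mu_cont sigma_sign phi dphi eps Heps' Happ F t0 F_J ht0
    (CInt_t0 lambda) (CInt_t0 mu) _ (kappa_limit t0 ht0)) as [v Hv].
  exists v. split; [|split].
  - apply filterlim_ext with (2 := Hv). intros s.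
    unfold X. now rewrite minv_fundamental_matrix.
  - apply fundamental_matrix_solution.
  - apply sup_on_le.
    (* The kernel estimate is available in the open interval; continuity carries the bound [K * eps]
       to the endpoints. *)
    apply (distance_le_endpoints I a b t0 phi _ dphi
             (fun t => mvec (A t) (mvec (X t) v))); auto.
    + apply HC.
    + apply fundamental_matrix_solution.
    + intros t Jt. unfold X. rewrite fundamental_matrix_propagator.
      apply Rle_trans with (eps * kappa t).
      * apply (distance_to_limit_le J lambda mu Lam M sigma) with (dphi := dphi) (F := F); auto.
      * rewrite Rmult_comm. apply Rmult_le_compat_r; auto. now apply kappa_le.
Qed.

Lemma sup_kappa_Ulam_constant : Ulam_constant I A K.
Proof.
  split. apply K_pos.
  intros eps Heps phi dphi HC Hr.
  destruct (limit_solution phi dphi eps Heps HC Hr) as [v [_ Hv]].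
  eexists; exact Hv.
Qed.

Lemma limit_solution_unique (phi dphi : R -> C2) (eps : R) :
  filterlim (fun t => RInt (fun s => Re (lambda s)) t0 t) F (Rbar_locally p_infty) ->
  0 < eps -> C1_on I phi dphi -> residual_le I A phi dphi eps ->
  exists v : C2,
    filterlim (fun t => mvec (minv (X t)) (phi t)) F (locally (T := C2_R_NormedModule) v) /\
    unique_solution_within I A phi (K * eps) (fun t => mvec (X t) v).
Proof.
  intros HF Heps HC Hr.
  destruct (limit_solution phi dphi eps Heps HC Hr) as [v [Hv [Hs Hd]]].
  exists v. split; auto. split; auto.
  intros y Hy Hyd.
  assert (HF' : filterlim (fun t => Re (Lam t)) F (Rbar_locally p_infty)).
  { apply filterlim_ext_loc with (2 := HF). generalize F_J. apply filter_imp.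
    intros t Jt. now apply RInt_Re. }
  assert (Ey : forall t, J t -> y t = propagator (Lam t) (M t) (y t0)).
  { intros t Jt.
    apply (solution_propagator J lambda mu); auto; try apply CInt_t0.
    intros s Js. apply is_derive_in_interior with I. now apply J_locally_I.
    now apply Hy, (Rbar_interval_incl I a b hI). }
  assert (E : y t0 = v).
  (* Both solutions lie within [K * eps] of [phi], hence within twice that of each other. *)
  { apply (bounded_propagator_unique J Lam M F) with (B := K * eps + K * eps); auto.
    intros t Jt. rewrite <- Ey by auto. unfold Lam, M.
    rewrite <- fundamental_matrix_propagator.
    assert (It : I t) by now apply (Rbar_interval_incl I a b hI).
    apply Rle_trans with (1 := norm_inf_triangle _ (phi t) _).
    apply Rplus_le_compat.
    - rewrite norm_inf_sym. exact (proj1 (sup_on_le I _ _) Hyd t It).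
    - exact (proj1 (sup_on_le I _ _) Hd t It). }
  (* Equality in the open interval passes to the endpoints as the distance bound 0. *)
  intros t It. apply norm_inf_eq_0. revert t It.
  apply (distance_le_endpoints I a b t0 _ _ (fun t => mvec (A t) (y t))
           (fun t => mvec (A t) (mvec (X t) v))); auto.
  intros t Jt. unfold X. rewrite fundamental_matrix_propagator, Ey, E by auto.
  apply Rmax_lub; simpl; unfold Cminus; rewrite Cplus_opp_r, Cmod_0; lra.
Qed.

End Direction.

End System.

(** * Improper integrals and endpoint filters *)

(** [at_point t] freezes one bound, so the limit along the product filter becomes an ordinary limit
    in the other bound. *)
Lemma is_RInt_gen_at_point_l (f : R -> R) (t l : R) (F : (R -> Prop) -> Prop)
    {FF : Filter F} :
  is_RInt_gen f (at_point t) F l -> filterlim (fun s => RInt f t s) F (locally l).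
Proof.
  intros H P HP. destruct (H P HP) as [Q S HQ HS HQS].
  unfold filtermap. apply filter_imp with (2 := HS). intros s Ss.
  destruct (HQS t s HQ Ss) as [y [Hy Py]]. simpl in Hy.
  now rewrite (is_RInt_unique (V := R_CompleteNormedModule) _ _ _ _ Hy).
Qed.

Lemma is_RInt_gen_at_point_r (f : R -> R) (t l : R) (F : (R -> Prop) -> Prop)
    {FF : Filter F} :
  is_RInt_gen f F (at_point t) l -> filterlim (fun s => RInt f s t) F (locally l).
Proof.
  intros H P HP. destruct (H P HP) as [Q S HQ HS HQS].
  unfold filtermap. apply filter_imp with (2 := HQ). intros s Ss.
  destruct (HQS s t Ss HS) as [y [Hy Py]]. simpl in Hy.
  now rewrite (is_RInt_unique (V := R_CompleteNormedModule) _ _ _ _ Hy).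
Qed.

Lemma Rbar_at_left_beyond (b : Rbar) (t : R) :
  Rbar_lt t b -> Rbar_at_left b (fun s => t < s /\ Rbar_lt s b).
Proof.
  intros H. unfold Rbar_at_left. apply filter_and; unfold within.
  - generalize (open_Rbar_gt' b t H).
    apply filter_imp. intros s Hs _; exact Hs.
  - apply filter_forall. auto.
Qed.

Lemma Rbar_at_right_beyond (a : Rbar) (t : R) :
  Rbar_lt a t -> Rbar_at_right a (fun s => s < t /\ Rbar_lt a s).
Proof.
  intros H. unfold Rbar_at_right. apply filter_and; unfold within.
  - generalize (open_Rbar_lt' a t H).
    apply filter_imp. intros s Hs _; exact Hs.
  - apply filter_forall. auto.
Qed.

(** The point [t] excludes [b = m_infty], where nothing lies to the left and the filter is
    improper. *)
Lemma Rbar_at_left_proper (b : Rbar) (t : R) :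
  Rbar_lt t b -> ProperFilter (Rbar_at_left b).
Proof.
  intros H. destruct b as [b | | ]; [exact (at_left_proper_filter b) | | easy].
  constructor; [|apply within_filter, Rbar_locally_filter].
  intros P [m Hm]. exists (m + 1). apply Hm; simpl; auto. lra.
Qed.

Lemma Rbar_at_right_proper (a : Rbar) (t : R) :
  Rbar_lt a t -> ProperFilter (Rbar_at_right a).
Proof.
  intros H. destruct a as [a | | ]; [exact (at_right_proper_filter a) | easy | ].
  constructor; [|apply within_filter, Rbar_locally_filter].
  intros P [m Hm]. exists (m - 1). apply Hm; simpl; auto. lra.
Qed.

Theorem theorem4p1 (I : R -> Prop) (a b : Rbar) (lambda mu : R -> C) (t0 : R)
  (hab : Rbar_lt a b)
  (hI : interval_with_endpoints I a b)
  (hlambda : continuous_on (T := R_UniformSpace) (U := C_UniformSpace) I lambda)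
  (hmu : continuous_on (T := R_UniformSpace) (U := C_UniformSpace) I mu)
  (ht0 : Rbar_lt a t0 /\ Rbar_lt t0 b) :
  let A := system_matrix lambda mu in
  let X := fundamental_matrix lambda mu t0 in
  ((forall t : R, I t ->
      ex_RInt_gen (kappa21_integrand lambda mu t) (at_point t) (Rbar_at_left b)) ->
   Rbar_lt (sup_on I (kappa21 lambda mu b)) p_infty ->
   let K21 := real (sup_on I (kappa21 lambda mu b)) in
   Ulam_stable I A /\ Ulam_constant I A K21 /\
   (filterlim (fun t => RInt (fun s => Re (lambda s)) t0 t)
      (Rbar_at_left b) (Rbar_locally p_infty) ->
    forall eps : R, 0 < eps ->
    forall phi dphi : R -> C2,
    C1_on I phi dphi -> residual_le I A phi dphi eps ->
    exists v : C2,
      filterlim (fun t => mvec (minv (X t)) (phi t))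
        (Rbar_at_left b) (locally (T := C2_R_NormedModule) v) /\
      unique_solution_within I A phi (K21 * eps) (fun t => mvec (X t) v)))
  /\
  ((forall t : R, I t ->
      ex_RInt_gen (kappa22_integrand lambda mu t) (Rbar_at_right a) (at_point t)) ->
   Rbar_lt (sup_on I (kappa22 lambda mu a)) p_infty ->
   let K22 := real (sup_on I (kappa22 lambda mu a)) in
   Ulam_stable I A /\ Ulam_constant I A K22 /\
   (filterlim (fun t => RInt (fun s => Re (lambda s)) t t0)
      (Rbar_at_right a) (Rbar_locally m_infty) ->
    forall eps : R, 0 < eps ->
    forall phi dphi : R -> C2,
    C1_on I phi dphi -> residual_le I A phi dphi eps ->
    exists v : C2,
      filterlim (fun t => mvec (minv (X t)) (phi t))
        (Rbar_at_right a) (locally (T := C2_R_NormedModule) v) /\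
      unique_solution_within I A phi (K22 * eps) (fun t => mvec (X t) v))).
Proof.
  intros A X.
  assert (J_between : forall t s r, Rbar_interval a b t -> Rbar_interval a b s ->
            Rmin t s < r < Rmax t s -> Rbar_interval a b r).
  { intros t s r Jt Js Hr.
    apply (convex_between _ (Rbar_interval_convex a b) t s); auto; lra. }
  assert (J_I := Rbar_interval_incl I a b hI).
  split.
  - intros Hex Hsup K21.
    assert (PF := Rbar_at_left_proper b t0 (proj2 ht0)).
    assert (FJ : Rbar_at_left b (Rbar_interval a b)).
    { generalize (Rbar_at_left_beyond b t0 (proj2 ht0)). apply filter_imp.
      intros s [H1 H2]. split; auto. now apply Rbar_lt_trans with t0. }
    assert (Fb : forall t, Rbar_interval a b t -> Rbar_at_left b (fun s => 0 < 1 * (s - t))).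
    { intros t [_ Ht]. generalize (Rbar_at_left_beyond b t Ht). apply filter_imp.
      intros s [Hs _]. lra. }
    assert (Hk : forall t, Rbar_interval a b t ->
      filterlim (fun s => 1 * RInt (kernel (CInt lambda t0) (CInt mu t0) t) t s)
        (Rbar_at_left b) (locally (kappa21 lambda mu b t))).
    { intros t Jt.
      apply filterlim_ext_loc with (fun s => RInt (kappa21_integrand lambda mu t) t s).
      - generalize FJ. apply filter_imp. intros s Js. rewrite Rmult_1_l.
        apply (RInt_ext (V := R_CompleteNormedModule)). intros r Hr.
        apply (kappa21_integrand_kernel I a b); auto. now apply J_between with t s.
      - apply is_RInt_gen_at_point_l; [apply PF|].
        apply (RInt_gen_correct (V := R_CompleteNormedModule)), Hex; auto. }
    assert (HU := sup_kappa_Ulam_constant I a b lambda mu t0 hI hlambda hmu ht0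
      (Rbar_at_left b) 1 (kappa21 lambda mu b) FJ (or_introl eq_refl) Fb Hk Hsup).
    split; [now exists K21 | split; [exact HU|]].
    intros HF eps Heps phi dphi.
    now apply (limit_solution_unique I a b lambda mu t0 hI hlambda hmu ht0
      (Rbar_at_left b) 1 (kappa21 lambda mu b) FJ (or_introl eq_refl) Fb Hk Hsup).
  - intros Hex Hsup K22.
    assert (PF := Rbar_at_right_proper a t0 (proj1 ht0)).
    assert (FJ : Rbar_at_right a (Rbar_interval a b)).
    { generalize (Rbar_at_right_beyond a t0 (proj1 ht0)). apply filter_imp.
      intros s [H1 H2]. split; auto. now apply Rbar_lt_trans with t0. }
    assert (Fb : forall t, Rbar_interval a b t -> Rbar_at_right a (fun s => 0 < -1 * (s - t))).
    { intros t [Ht _]. generalize (Rbar_at_right_beyond a t Ht). apply filter_imp.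
      intros s [Hs _]. lra. }
    assert (Hk : forall t, Rbar_interval a b t ->
      filterlim (fun s => -1 * RInt (kernel (CInt lambda t0) (CInt mu t0) t) t s)
        (Rbar_at_right a) (locally (kappa22 lambda mu a t))).
    { intros t Jt.
      apply filterlim_ext_loc with (fun s => RInt (kappa22_integrand lambda mu t) s t).
      - generalize FJ. apply filter_imp. intros s Js.
        (* The sign -1 reverses the integral from [t] to [s] into the one from [s] to [t] that
           defines [kappa22]. *)
        replace (-1 * _) with (- RInt (kernel (CInt lambda t0) (CInt mu t0) t) t s) by ring.
        rewrite <- (RInt_kernel_swap (Rbar_interval a b) lambda mu); auto.
        + apply (RInt_ext (V := R_CompleteNormedModule)). intros r Hr.
          apply (kappa22_integrand_kernel I a b); auto. now apply J_between with s t.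
        + apply Rbar_interval_convex.
        + intros r Jr. now apply (CInt_derive I a b).
        + intros r Jr. now apply (CInt_derive I a b).
      - apply is_RInt_gen_at_point_r; [apply PF|].
        apply (RInt_gen_correct (V := R_CompleteNormedModule)), Hex; auto. }
    assert (HU := sup_kappa_Ulam_constant I a b lambda mu t0 hI hlambda hmu ht0
      (Rbar_at_right a) (-1) (kappa22 lambda mu a) FJ (or_intror eq_refl) Fb Hk Hsup).
    split; [now exists K22 | split; [exact HU|]].
    intros HF eps Heps phi dphi.
    apply (limit_solution_unique I a b lambda mu t0 hI hlambda hmu ht0
      (Rbar_at_right a) (-1) (kappa22 lambda mu a) FJ (or_intror eq_refl) Fb Hk Hsup); auto.
    (* Reversing the bounds turns the limit minus infinity of the hypothesis into plus infinity for
       the integral from [t0] to [t]. *)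
    apply filterlim_ext_loc with (fun t => - RInt (fun s => Re (lambda s)) t t0).
    + generalize FJ. apply filter_imp. intros t Jt.
      rewrite !(RInt_Re I a b) by auto.
      rewrite (CInt_Chasles I a b t0 hI ht0 lambda t t0), (CInt_t0 t0 lambda) by auto.
      unfold Re; simpl. ring.
    + apply (filterlim_comp _ _ _ _ Ropp _ _ _ HF).
      exact (filterlim_Rbar_opp m_infty).
Qed.
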